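(* Let $G$ be a finite digraph (at most one edge from $v$ to $w$ for each ordered pair of distinct vertices $v,w$; any finite number of loops allowed at each vertex). Then the pair $(E(G),\mathrm{Mult}(G))$ is a matroid with ground set $E(G)$ and family of independent sets $\mathrm{Mult}(G)$ if and only if both of the following hold: (MP1) $G$ contains no subgraph isomorphic to either of the digraphs $D_A$, $D_B$ described below, nor to the digraphs obtained from $D_A$ or $D_B$ by reversing the orientation of all edges; (MP2) every coherently oriented cycle of length at least $2$ in $G$ (loops excluded) is a connected component of $G$. Here $D_A$ has vertices $v_0,v_1,v_2$ and edges $(v_1,v_0),(v_0,v_2),(v_1,v_2)$; $D_B$ has vertices $v_0,v_1,v_2,v_3$ and edges $(v_0,v_1),(v_2,v_1),(v_2,v_3)$.
   Context: A digraph $G$ consists of finite sets $V(G)$, $E(G)$; each edge has a source and a target; an edge from $v$ to $w$ with $v\neq w$ is written $(v,w)$ and there is at most one such edge; an edge with equal source and target is a loop, and several loops may sit at one vertex. A subgraph $H\le G$ has $V(H)\subseteq V(G)$, $E(H)\subseteq E(G)$; it is spanning if $V(H)=V(G)$. A simple path is a sequence of non-loop edges $e_1,\dots,e_n$ with $t(e_i)=s(e_{i+1})$, no vertex encountered twice, and $s(e_1)\neq t(e_n)$. A multipath of $G$ is a spanning subgraph each of whose connected components is either a single vertex or a simple path; $\mathrm{Mult}(G)$ is the set of multipaths, each identified with its set of edges (so $\mathrm{Mult}(G)\subseteq\mathcal P(E(G))$). A coherently oriented cycle of length $n\ge 2$ is a subgraph with distinct vertices $v_1,\dots,v_n$ and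 edges $(v_1,v_2),\dots,(v_{n-1},v_n),(v_n,v_1)$ (for $n=2$ this is a pair of opposite edges). A matroid on a finite set $X$ is a family $\mathcal I\subseteq\mathcal P(X)$ containing $\emptyset$, closed under subsets, and such that if $A,B\in\mathcal I$ with $|A|>|B|$ there is $x\in A$ with $B\cup\{x\}\in\mathcal I$.
   Formalization: The exchange axiom is taken in its standard form (x in A but not in B), since with x merely in A the claim fails; and in (MP2) loops are ignored when deciding whether a cycle is a connected component, since a 2-cycle with an added loop still gives a matroid. *)

(* Defs.v *)
From mathcomp Require Import all_boot.

Set Implicit Arguments.
Unset Strict Implicit.
Unset Printing Implicit Defensive.

Record digraph := Digraph {
  vertex : finType;
  edge : finType;
  src : edge -> vertex;
  tgt : edge -> vertex;
  nonloop_edge_uniq : forall e f : edge,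
    src e != tgt e -> src e = src f -> tgt e = tgt f -> e = f }.

Arguments src {d} e.
Arguments tgt {d} e.

Definition is_loop (G : digraph) (e : edge G) : bool := src e == tgt e.

Record subgraph (G : digraph) := Subgraph {
  sV : {set vertex G};
  sE : {set edge G};
  sE_closed : [forall e in sE, (src e \in sV) && (tgt e \in sV)] }.

Definition spanning (G : digraph) (H : subgraph G) : Prop :=
  sV H = [set: vertex G].

(* Adjacency in [H], disregarding orientation. *)
Definition adj (G : digraph) (H : subgraph G) : rel (vertex G) :=
  fun u w => [exists e in sE H,
    ((src e == u) && (tgt e == w)) || ((src e == w) && (tgt e == u))].

(* [K] is the connected component of [H] containing some vertex [v]; its edges
   are all the edges of [H], loops included, between its vertices. *)
Definition is_component (G : digraph) (K H : subgraph G) : Prop :=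
  exists2 v, v \in sV H &
    sV K = [set w | connect (adj H) v w] /\
    sE K = [set e in sE H | (src e \in sV K) && (tgt e \in sV K)].

Definition simple_path (G : digraph) (e1 : edge G) (p : seq (edge G)) : Prop :=
  [/\ all (fun e => ~~ is_loop e) (e1 :: p),
      path (fun e f => tgt e == src f) e1 p,
      uniq (src e1 :: map tgt (e1 :: p))
    & src e1 != tgt (last e1 p)].

Definition is_single_vertex (G : digraph) (K : subgraph G) : Prop :=
  exists v, sV K = [set v] /\ sE K = set0.

Definition is_simple_path (G : digraph) (K : subgraph G) : Prop :=
  exists e1 p, [/\ simple_path e1 p,
    sV K = [set x in src e1 :: map tgt (e1 :: p)]
    & sE K = [set e in e1 :: p]].

Definition multipath (G : digraph) (H : subgraph G) : Prop :=
  spanning H /\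
  forall K : subgraph G,
    is_component K H -> is_single_vertex K \/ is_simple_path K.

Definition Mult (G : digraph) (A : {set edge G}) : Prop :=
  exists H : subgraph G, multipath H /\ sE H = A.

(* [es] lists the edges (v_1,v_2), ..., (v_{n-1},v_n), (v_n,v_1) in order. *)
Definition is_coherent_cycle (G : digraph) (C : subgraph G) : Prop :=
  exists (vs : seq (vertex G)) (es : seq (edge G)),
    [/\ 2 <= size vs, uniq vs,
        map src es = vs /\ map tgt es = rot 1 vs
      & sV C = [set x in vs] /\ sE C = [set e in es]].

Definition matroid (T : finType) (I : {set T} -> Prop) : Prop :=
  [/\ I set0,
      forall A B : {set T}, A \subset B -> I B -> I A
    & forall A B : {set T}, I A -> I B -> #|B| < #|A| ->
        exists2 x, x \in A :\: B & I (x |: B)].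

Lemma rev_nonloop_edge_uniq (G : digraph) (e f : edge G) :
  tgt e != src e -> tgt e = tgt f -> src e = src f -> e = f.
Proof.
by rewrite eq_sym => nl et es; apply: nonloop_edge_uniq.
Qed.

Definition rev_digraph (G : digraph) : digraph :=
  Digraph (@rev_nonloop_edge_uniq G).

Lemma rel_nonloop_edge_uniq (V : finType) (r : rel V)
    (e f : {p : V * V | r p.1 p.2}) :
  (val e).1 != (val e).2 -> (val e).1 = (val f).1 -> (val e).2 = (val f).2 ->
  e = f.
Proof.
move=> _ e1 e2; apply: val_inj.
by rewrite [val e]surjective_pairing [val f]surjective_pairing e1 e2.
Qed.

Definition digraph_of_rel (V : finType) (r : rel V) : digraph :=
  Digraph (@rel_nonloop_edge_uniq V r).

Lemma loopless_closed (G : digraph) :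
  [forall e in [set e : edge G | ~~ is_loop e],
    (src e \in [set: vertex G]) && (tgt e \in [set: vertex G])].
Proof. by apply/forall_inP => e _; rewrite !in_setT. Qed.

Definition loopless (G : digraph) : subgraph G := Subgraph (loopless_closed G).

Definition D_A : digraph := digraph_of_rel
  (fun u w : 'I_3 =>
     (nat_of_ord u, nat_of_ord w) \in [:: (1, 0); (0, 2); (1, 2)]).

Definition D_B : digraph := digraph_of_rel
  (fun u w : 'I_4 =>
     (nat_of_ord u, nat_of_ord w) \in [:: (0, 1); (2, 1); (2, 3)]).

Definition iso_onto (D G : digraph) (H : subgraph G) : Prop :=
  exists (fV : vertex D -> vertex G) (fE : edge D -> edge G),
    [/\ injective fV /\ injective fE,
        fV @: [set: vertex D] = sV H /\ fE @: [set: edge D] = sE H,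
        forall e, src (fE e) = fV (src e)
      & forall e, tgt (fE e) = fV (tgt e)].

Definition contains (G D : digraph) : Prop :=
  exists H : subgraph G, iso_onto D H.

Definition MP1 (G : digraph) : Prop :=
  [/\ ~ contains G D_A, ~ contains G D_B,
      ~ contains G (rev_digraph D_A) & ~ contains G (rev_digraph D_B)].

(* Loops are disregarded when forming components: a 2-cycle with an extra loop
   at one of its vertices satisfies [MP2], as it must since a loop belongs to no
   multipath. *)
Definition MP2 (G : digraph) : Prop :=
  forall C : subgraph G, is_coherent_cycle C -> is_component C (loopless G).

(* Main.v *)
(** A set of edges is a multipath iff [src] and [tgt] are injective on it and it
    contains no nonempty set [S] of edges with [tgt @: S \subset src @: S], i.e.
    no coherent cycle.  Call two edges in conflict when they share their source
    or their target.

    Up to isomorphism, [D_A] and [D_B] are the two shapes of a zigzag: non-loop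
    edges [x != y != z] with [tgt x = tgt y] and [src y = src z].  Without
    zigzags, conflict is transitive on non-loop edges, and under (MP2) the edges
    of a coherent cycle conflict with no other edge.  If no edge of [A :\: B] can
    be added to [B], send [x] in [A :\: B] to an edge of [B :\: A] that
    conflicts with [x] or lies on the cycle created by [x]; this is injective, so
    [#|A| <= #|B|].

    Conversely, a zigzag violates exchange for [{x, z}] and [{y}].  If a non-loop
    edge [x] outside a coherent cycle [C] meets [C], then either both of its
    endpoints are on [C], which gives a zigzag, or [x] conflicts with exactly one
    [e] in [C], and exchange fails for [C - e + x] and [C - g], where [g != e]. *)

Require Import Defs.
From mathcomp Require Import all_boot.

Set Implicit Arguments.
Unset Strict Implicit.
Unset Printing Implicit Defensive.

Lemma uniq_map_inj_in (T U : eqType) (f : T -> U) (s : seq T) :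
  uniq (map f s) -> {in s &, injective f}.
Proof.
elim: s => //= a s IH /andP[fa us] x y.
rewrite !inE => /predU1P[->|xs] /predU1P[->|ys] // fxy.
- by rewrite fxy map_f in fa.
- by rewrite -fxy map_f in fa.
- exact: IH.
Qed.

(** * Multipaths characterised by injectivity of [src] and [tgt] and acyclicity *)

Section LinearForests.
Variable G : digraph.
Implicit Types (A B S : {set edge G}) (e f x y z : edge G) (p q : seq (edge G)).

(** Cycles are excluded through sets in which every edge has a successor, so no cyclic list has to
    be exhibited. A loop alone is such a set, hence loops are excluded too. *)
Definition acyclic A : bool :=
  [forall S : {set edge G},
    (S \subset A) && (tgt @: S \subset src @: S) ==> (S == set0)].

Definition linear_forest A : bool :=
  [&& dinjectiveb src A, dinjectiveb tgt A & acyclic A].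

Lemma acyclicP A :
  reflect (forall S, S \subset A -> tgt @: S \subset src @: S -> S = set0)
          (acyclic A).
Proof.
apply: (iffP forallP) => [acA S sSA cS|acA S].
  by apply/eqP; have := acA S; rewrite sSA cS.
by apply/implyP => /andP[sSA cS]; apply/eqP/acA.
Qed.

Lemma linear_forestP A :
  reflect [/\ {in A &, injective src}, {in A &, injective tgt}
            & forall S, S \subset A -> tgt @: S \subset src @: S -> S = set0]
          (linear_forest A).
Proof.
by apply: (iffP and3P) => -[/dinjectiveP ? /dinjectiveP ? /acyclicP ?].
Qed.

Lemma linear_forestS A B : A \subset B -> linear_forest B -> linear_forest A.
Proof.
move=> sAB /linear_forestP[si ti ac]; apply/linear_forestP; split.
- exact: sub_in2 (subsetP sAB) _ si.
- exact: sub_in2 (subsetP sAB) _ ti.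
- by move=> S sSA; apply: ac; apply: subset_trans sAB.
Qed.

Lemma linear_forest0 : linear_forest set0.
Proof.
apply/linear_forestP; split; try by move=> e f; rewrite inE.
by move=> S; rewrite subset0 => /eqP.
Qed.

Lemma linear_forest_nonloop A e : linear_forest A -> e \in A -> ~~ is_loop e.
Proof.
move=> /linear_forestP[_ _ ac] eA; apply/negP => /eqP le.
have /setP/(_ e) : [set e] = set0.
  by apply: ac; rewrite ?sub1set // !imset_set1 le.
by rewrite !inE eqxx.
Qed.

Definition chain : rel (edge G) := fun e f => tgt e == src f.

Lemma chainE e q : path chain e q = (map tgt (belast e q) == map src q).
Proof. by elim: q e => //= f q IH e; rewrite IH eqseq_cons. Qed.

(** Allows a vertex of the path to be treated as a target (or the start) or as a source (or the
    end), whichever injectivity is to be applied. *)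
Lemma chain_vertices e p : path chain e p ->
  src e :: map tgt (e :: p) = rcons (map src (e :: p)) (tgt (last e p)).
Proof.
rewrite chainE => /eqP c.
by rewrite [map src _]map_cons rcons_cons -c -map_rcons -lastI.
Qed.

Definition dir_adj A : rel (vertex G) :=
  fun u w => [exists e in A, (src e == u) && (tgt e == w)].

Lemma dir_adj_edge A e : e \in A -> dir_adj A (src e) (tgt e).
Proof. by move=> eA; apply/exists_inP; exists e; rewrite ?eqxx. Qed.

Lemma chain_path A e p : path chain e p -> {subset e :: p <= A} ->
  path (dir_adj A) (src e) (map tgt (e :: p)).
Proof.
elim: p e => [|f p IH] e /=; first by move=> _ sA; rewrite dir_adj_edge ?sA ?mem_head.
move=> /andP[/eqP ef cp] sA; rewrite dir_adj_edge ?sA ?mem_head // ef /=.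
by apply: IH => // x xp; apply: sA; rewrite inE xp orbT.
Qed.

Lemma adj_sym (H : subgraph G) : symmetric (adj H).
Proof.
by move=> u w; apply: eq_existsb => e; rewrite orbC.
Qed.

Lemma dir_adj_sub (H : subgraph G) : subrel (dir_adj (sE H)) (adj H).
Proof.
by move=> u w /exists_inP[e eH uw]; apply/exists_inP; exists e; rewrite ?uw.
Qed.

Lemma adj_edge (H : subgraph G) e : e \in sE H -> adj H (src e) (tgt e).
Proof. by move=> eH; apply/dir_adj_sub/dir_adj_edge. Qed.

Lemma connect_adj_closed (H : subgraph G) (W : {set vertex G}) u w :
    (forall e, e \in sE H -> (src e \in W) || (tgt e \in W) ->
      (src e \in W) && (tgt e \in W)) ->
  connect (adj H) u w -> u \in W -> w \in W.
Proof.
move=> cW uw uW; rewrite -(closed_connect _ uw) //.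
apply: intro_closed; first exact/sym_connect_sym/adj_sym.
move=> a b /exists_inP[e eH /orP[]/andP[/eqP<- /eqP<-]] aW.
  by have := cW _ eH; rewrite aW => /(_ isT)/andP[].
by have := cW _ eH; rewrite aW orbT => /(_ isT)/andP[].
Qed.

(** The edge at position [i] runs from vertex [i] to vertex [i + 1] of [vs]. The position is thus a
    potential that increases along edges. *)
Lemma chain_rank e1 p (vs := src e1 :: map tgt (e1 :: p)) e :
    path chain e1 p -> uniq vs -> e \in e1 :: p ->
  index (tgt e) vs = (index (src e) vs).+1.
Proof.
move=> cp uvs ep.
set i := index e (e1 :: p).
have ip : i < size (e1 :: p) by rewrite index_mem.
have sz : size vs = (size (e1 :: p)).+1 by rewrite /= size_map.
have <- : nth (src e1) vs i.+1 = tgt e.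
  by rewrite -[in RHS](nth_index e1 ep) -(nth_map e1 (src e1)).
have <- : nth (src e1) vs i = src e.
  by rewrite /vs chain_vertices // nth_rcons size_map ip (nth_map e1) ?nth_index.
by rewrite !index_uniq // sz ltnS // ltnW.
Qed.

(** An edge of [S] whose source lies furthest along the path has no successor in [S]. *)
Lemma chain_nonclosed e1 p S :
    path chain e1 p -> uniq (src e1 :: map tgt (e1 :: p)) ->
    {subset S <= e1 :: p} -> tgt @: S \subset src @: S -> S = set0.
Proof.
move=> cp uvs sS clS; apply/eqP/set0Pn => -[e0 e0S].
pose r e := index (src e) (src e1 :: map tgt (e1 :: p)).
case: (@arg_maxnP _ e0 (mem S) r e0S) => e eS emax.
have /imsetP[f fS ef] : tgt e \in src @: S by rewrite (subsetP clS) ?imset_f.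
have := emax f fS; rewrite /r -ef chain_rank ?sS //.
by rewrite /= ltnn.
Qed.

Fact component_subproof (H : subgraph G) (v : vertex G)
    (W := [set w | connect (adj H) v w]) :
  [forall e in [set e in sE H | (src e \in W) && (tgt e \in W)],
    (src e \in W) && (tgt e \in W)].
Proof. by apply/forall_inP => e; rewrite inE => /andP[]. Qed.

Definition component (H : subgraph G) (v : vertex G) : subgraph G :=
  Subgraph (component_subproof H v).

Lemma component_is_component (H : subgraph G) v :
  v \in sV H -> is_component (component H v) H.
Proof. by exists v. Qed.

(** The component through [e] has an edge, so it is not a single vertex and must be a simple
    path. *)
Lemma multipath_chain (H : subgraph G) e : multipath H -> e \in sE H ->
  exists e1 p, [/\ path chain e1 p, uniq (src e1 :: map tgt (e1 :: p)),
    {in e1 :: p, forall f, ~~ is_loop f}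
    & forall f, f \in sE H -> connect (adj H) (src e) (src f) -> f \in e1 :: p].
Proof.
move=> [spH mH] eH.
have inK f : f \in sE H -> connect (adj H) (src e) (src f) ->
    f \in sE (component H (src e)).
  move=> fH ef; rewrite !inE fH ef.
  by rewrite (connect_trans ef) // connect1 // adj_edge.
have := mH _ (component_is_component (_ : src e \in sV H)).
rewrite spH in_setT => /(_ isT) [[v [_ K0]]|].
  by have := inK e eH (connect0 _ _); rewrite K0 inE.
move=> [e1 [p [[/allP nl cp up _] _ eqE]]]; exists e1, p; split => //.
by move=> f fH ef; have := inK f fH ef; rewrite eqE inE.
Qed.

Lemma multipath_linear_forest (H : subgraph G) :
  multipath H -> linear_forest (sE H).
Proof.
move=> mH; apply/linear_forestP; split.
- move=> e f eH fH ef.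
  have [e1 [p [cp up nl inp]]] := multipath_chain mH eH.
  have ep := inp e eH (connect0 _ _).
  have fp : f \in e1 :: p by apply: inp; rewrite // ef connect0.
  apply: nonloop_edge_uniq => //; first exact: nl.
  have tin g : g \in e1 :: p -> tgt g \in src e1 :: map tgt (e1 :: p).
    by move=> gp; rewrite inE map_f ?orbT.
  (* Equal sources have equal positions on the path, so the targets have equal positions as well. *)
  by apply: (index_inj (src e1) (tin e ep) (tin f fp)); rewrite !chain_rank // ef.
- move=> e f eH fH ef.
  have [e1 [p [cp up nl inp]]] := multipath_chain mH eH.
  have ep := inp e eH (connect0 _ _).
  have fp : f \in e1 :: p.
    apply: inp => //; apply: (@connect_trans _ _ (tgt e)); apply: connect1.
      exact: adj_edge.
    by rewrite adj_sym ef adj_edge.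
  by move: up => /= /andP[_ up]; apply: (uniq_map_inj_in (f := tgt) (s := e1 :: p)).
- move=> S sSH clS; apply/eqP/set0Pn => -[e eS].
  have eH := subsetP sSH _ eS.
  have [e1 [p [cp up nl inp]]] := multipath_chain mH eH.
  (* Cutting [S] down to one component keeps it closed, because the successor of an edge lies in the
     same component. *)
  pose S' := [set f in S | connect (adj H) (src e) (src f)].
  suff /setP/(_ e) : S' = set0 by rewrite !inE eS connect0.
  apply: (chain_nonclosed cp up).
    by move=> f; rewrite inE => /andP[fS ef]; apply: inp; rewrite ?(subsetP sSH).
  apply/subsetP => _ /imsetP[f + ->]; rewrite inE => /andP[fS ef].
  have /imsetP[g gS fg] : tgt f \in src @: S by rewrite (subsetP clS) ?imset_f.
  rewrite fg imset_f // inE gS -fg (connect_trans ef) // connect1 //.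
  exact/adj_edge/(subsetP sSH).
Qed.

(** * Maximal trails in a linear forest *)

Section Maximal.
Variables (A : {set edge G}) (lfA : linear_forest A).

Definition trail_in e1 p :=
  [/\ path chain e1 p, uniq (src e1 :: map tgt (e1 :: p))
    & {subset e1 :: p <= A}].

(** Otherwise the trail together with [e] would be a nonempty closed subset of [A]. *)
Lemma trail_not_closed e1 p e : trail_in e1 p -> e \in A ->
  src e = tgt (last e1 p) -> tgt e != src e1.
Proof.
move=> [cp up sA] eA es; apply/eqP => et.
have /linear_forestP[_ _ ac] := lfA.
have /setP/(_ e) : e |: [set f in e1 :: p] = set0.
  apply: ac.
    by apply/subsetP => f; rewrite in_setU1 inE => /predU1P[->//|/sA].
  apply/subsetP => _ /imsetP[f + ->].
  rewrite in_setU1 inE => /predU1P[->|fp].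
    by rewrite et imset_f // in_setU1 inE mem_head orbT.
  have : tgt f \in src e1 :: map tgt (e1 :: p) by rewrite inE map_f ?orbT.
  rewrite chain_vertices // mem_rcons inE -es => /predU1P[->|/mapP[g gp ->]].
    by rewrite imset_f // setU11.
  by rewrite imset_f // in_setU1 inE gp orbT.
by rewrite setU11 inE.
Qed.

(** The new endpoint is fresh: it is not the start, by [trail_not_closed], and if it were another
    target then [e] would already be on the trail, making the end of the trail a source of one of
    its edges. *)
Lemma trail_extend_right e1 p e : trail_in e1 p -> e \in A ->
  src e = tgt (last e1 p) -> trail_in e1 (rcons p e).
Proof.
move=> tp eA es; have ne := trail_not_closed tp eA es; case: tp => cp up sA.
have /linear_forestP[_ ti _] := lfA.
have sA' : {subset e1 :: rcons p e <= A}.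
  by move=> f; rewrite -rcons_cons mem_rcons inE => /predU1P[->|/sA].
split=> //; first by rewrite rcons_path cp /chain es /=.
rewrite -rcons_cons map_rcons -rcons_cons rcons_uniq up andbT.
rewrite inE (negbTE ne) orFb; apply/mapP => -[f fp ef].
have {}ef : e = f by apply: ti => //; apply: sA.
have := up; rewrite chain_vertices // rcons_uniq -es ef => /andP[/negP[]].
by rewrite map_f.
Qed.

Lemma trail_extend_left e1 p e : trail_in e1 p -> e \in A ->
  tgt e = src e1 -> trail_in e (e1 :: p).
Proof.
move=> tp eA et; have := trail_not_closed tp eA; case: (tp) => cp up sA.
move=> ne; have /linear_forestP[si _ _] := lfA.
split; first by rewrite /= /chain et eqxx.
  rewrite cons_uniq [map tgt (e :: _)]map_cons et up andbT.
  rewrite chain_vertices // mem_rcons inE; apply/norP; split.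
    by apply/eqP => /ne; rewrite et eqxx.
  apply/mapP => -[f fp ef].
  have {}ef : e = f by apply: si => //; apply: sA.
  by move: up; rewrite cons_uniq => /andP[/negP[]]; rewrite -et ef map_f.
by move=> f; rewrite inE => /predU1P[->|/sA].
Qed.

Lemma trail_size e1 p : trail_in e1 p -> size p < #|A|.
Proof.
case=> _ /=/andP[_ up] sA; have {}up := @map_uniq _ _ tgt (e1 :: p) up.
have /(uniq_leq_size up) : {subset e1 :: p <= enum A}.
  by move=> f /sA; rewrite mem_enum.
by rewrite -cardE.
Qed.

(** The trail is extended at either end while possible; its length is bounded by [#|A|]. When it is
    stuck, injectivity of [src] and [tgt] puts every edge of [A] touching it on the trail.
    Extensions keep all vertices, so [v] stays on it. *)
Lemma trail_maximal v e1 p : trail_in e1 p -> v \in src e1 :: map tgt (e1 :: p) ->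
  exists e1' p', [/\ trail_in e1' p', v \in src e1' :: map tgt (e1' :: p')
   & {in A, forall e, (src e \in src e1' :: map tgt (e1' :: p'))
     || (tgt e \in src e1' :: map tgt (e1' :: p')) -> e \in e1' :: p'}].
Proof.
have [n] := ubnP (#|A| - size p); elim: n e1 p => // n IH e1 p szn tp vp.
have ltA := trail_size tp.
have [/exists_inP[e eA /eqP es]|nR] :=
    boolP [exists e in A, src e == tgt (last e1 p)].
  apply: (IH e1 (rcons p e)); last 1 first.
  - by rewrite -rcons_cons map_rcons -rcons_cons mem_rcons in_cons vp orbT.
  - by rewrite ?size_rcons (leq_trans (ltn_sub2l ltA (ltnSn _))).
  - exact: trail_extend_right.
have [/exists_inP[e eA /eqP et]|nL] := boolP [exists e in A, tgt e == src e1].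
  apply: (IH e (e1 :: p)); last 1 first.
  - by rewrite [map _ (e :: _)]map_cons et in_cons vp orbT.
  - by rewrite ?size_rcons (leq_trans (ltn_sub2l ltA (ltnSn _))).
  - exact: trail_extend_left.
exists e1, p; split=> // e eA.
case: tp => cp up sA; have /linear_forestP[si ti _] := lfA.
case/orP.
  rewrite chain_vertices // mem_rcons inE => /predU1P[es|/mapP[f fp ef]].
    by case/exists_inP: nR; exists e; rewrite // es.
  by rewrite (si e f) // sA.
rewrite inE => /predU1P[et|/mapP[f fp ef]].
  by case/exists_inP: nL; exists e; rewrite // et.
by rewrite (ti e f) // sA.
Qed.

End Maximal.

Fact spanning_subproof A :
  [forall e in A, (src e \in [set: vertex G]) && (tgt e \in [set: vertex G])].
Proof. by apply/forall_inP => e _; rewrite !in_setT. Qed.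

Definition spanning_subgraph A : subgraph G := Subgraph (spanning_subproof A).

(** If no edge of [A] touches [v], its component is a single vertex. Otherwise a maximal trail
    through [v] has a vertex set closed under adjacency, and so is the whole component. *)
Lemma linear_forest_multipath A :
  linear_forest A -> multipath (spanning_subgraph A).
Proof.
move=> lfA; split=> // K [v _ [VK EK]].
set H := spanning_subgraph A in VK EK.
have [/exists_inP[e eA ve]|iso] :=
    boolP [exists e in A, (src e == v) || (tgt e == v)]; last first.
  left; exists v; have VKv : sV K = [set v].
    apply/setP => w; rewrite VK !inE; apply/idP/eqP => [vw|->]; last first.
      exact: connect0.
    apply/set1P; apply: (connect_adj_closed (W := [set v])) vw _.
      2: exact: set11.
    move=> e eA; rewrite !inE => ve; case/exists_inP: iso; exists e => //.
  split=> //; rewrite EK VKv; apply/setP => e; rewrite !inE.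
  apply/negP => /and3P[eA ve _]; case/exists_inP: iso; exists e => //.
  by rewrite ve.
right.
have te : trail_in A e [::].
  split=> //=; last by move=> f; rewrite inE => /eqP->.
  by rewrite !inE andbT; apply: linear_forest_nonloop lfA eA.
have [|e1 [p [[cp up sA] vp mp]]] := trail_maximal lfA (v := v) te.
  by rewrite !inE ![v == _]eq_sym.
have nl : all (fun f => ~~ is_loop f) (e1 :: p).
  by apply/allP => f /sA; apply: linear_forest_nonloop.
have endp f : f \in e1 :: p ->
    (src f \in src e1 :: map tgt (e1 :: p)) &&
    (tgt f \in src e1 :: map tgt (e1 :: p)).
  move=> fp; rewrite {1}chain_vertices // mem_rcons inE map_f // orbT.
  by rewrite inE map_f // orbT.
have VKp : sV K = [set x in src e1 :: map tgt (e1 :: p)].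
  rewrite VK; apply/setP => w; rewrite !in_set; apply/idP/idP => [vw|wp].
    have := connect_adj_closed (W := [set x in src e1 :: map tgt (e1 :: p)])
      (H := H) _ vw.
    rewrite !in_set; apply=> // f fA; rewrite !in_set => /(mp _ fA).
    exact: endp.
  have ap : path (adj H) (src e1) (map tgt (e1 :: p)).
    exact: sub_path (@dir_adj_sub H) _ _ (chain_path cp sA).
  rewrite (@connect_trans _ _ (src e1)) ?(path_connect ap) //.
  by rewrite (sym_connect_sym (adj_sym H)) (path_connect ap).
exists e1, p; split=> //.
  split=> //; move: up; rewrite cons_uniq => /andP[+ _]; apply: contraNN.
  by move/eqP->; rewrite map_f // mem_last.
rewrite EK VKp; apply/setP => f; rewrite !in_set.
apply/andP/idP => [[fA /andP[fp _]]|fp]; first by rewrite mp ?fp.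
by rewrite sA // endp.
Qed.

Lemma MultP A : Mult A <-> linear_forest A.
Proof.
split=> [[H [mH <-]]|lfA]; first exact: multipath_linear_forest.
by exists (spanning_subgraph A); split; first exact: linear_forest_multipath.
Qed.

End LinearForests.

(** * Coherent cycles as minimal nonempty closed edge sets *)

Section CoherentCycles.
Variable G : digraph.
Implicit Types (A B S : {set edge G}) (C K : subgraph G) (e f g x y z : edge G).

Lemma chain_cycleE (es : seq (edge G)) :
  cycle (@chain G) es = (map tgt es == rot 1 (map src es)).
Proof.
case: es => //= e q.
by rewrite chainE belast_rcons rot1_cons map_rcons.
Qed.

Lemma coherent_cycle_chain C : is_coherent_cycle C -> exists es,
  [/\ 2 <= size es, uniq (map src es), cycle (@chain G) es,
      sV C = [set x in map src es] & sE C = [set e in es]].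
Proof.
move=> [vs [es [szv uvs [svs tvs] [VC EC]]]]; exists es.
by rewrite -(size_map src) chain_cycleE tvs svs eqxx.
Qed.

Lemma coherent_cycle_src C : is_coherent_cycle C -> src @: sE C = sV C.
Proof.
move=> /coherent_cycle_chain[es [_ _ _ -> ->]]; apply/setP => u; rewrite inE.
apply/imsetP/mapP => -[e]; first by rewrite inE; exists e.
by move=> ees ->; exists e; rewrite ?inE.
Qed.

Lemma coherent_cycle_tgt C : is_coherent_cycle C -> tgt @: sE C = sV C.
Proof.
move=> /coherent_cycle_chain[es [_ _ + -> ->]]; rewrite chain_cycleE => /eqP ts.
apply/setP => u; rewrite inE -(mem_rot 1) -ts.
apply/imsetP/mapP => -[e]; first by rewrite inE; exists e.
by move=> ees ->; exists e; rewrite ?inE.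
Qed.

Lemma coherent_cycle_src_inj C :
  is_coherent_cycle C -> {in sE C &, injective src}.
Proof.
move=> /coherent_cycle_chain[es [_ us _ _ ->]] e f; rewrite !inE.
exact: uniq_map_inj_in.
Qed.

Lemma coherent_cycle_tgt_inj C :
  is_coherent_cycle C -> {in sE C &, injective tgt}.
Proof.
move=> /coherent_cycle_chain[es [_ us + _ ->]] e f; rewrite !inE.
rewrite chain_cycleE => /eqP ts; apply: uniq_map_inj_in.
by rewrite ts rot_uniq.
Qed.

Lemma coherent_cycle_connect C : is_coherent_cycle C ->
  {in sV C &, forall u w, connect (dir_adj (sE C)) u w}.
Proof.
move=> /coherent_cycle_chain[es [_ _ ces -> ->]] u w; rewrite !inE.
apply: connect_cycle; move: ces.
apply: (homo_cycle_in (P := mem es)); last exact/allP.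
by move=> e f ees _ /eqP <-; apply: dir_adj_edge; rewrite inE.
Qed.

Lemma coherent_cycle_neq C e : is_coherent_cycle C ->
  exists2 g, g \in sE C & g != e.
Proof.
move=> /coherent_cycle_chain[[|a [|b es]] [] //= _ /andP[+ _] _ _ EC].
rewrite inE => /norP[ab _].
have [ae|ae] := eqVneq a e; last by exists a; rewrite // EC !inE eqxx.
exists b; first by rewrite EC !inE eqxx orbT.
by rewrite -ae eq_sym; apply: contraNneq ab => ->.
Qed.

(** Each vertex of [C] has one outgoing edge in [C], so following the cycle from a source of an edge
    of [S] never leaves [src @: S]. As the cycle is strongly connected, every edge of it is
    reached. *)
Lemma coherent_cycle_minimal C S : is_coherent_cycle C ->
  S \subset sE C -> tgt @: S \subset src @: S -> S != set0 -> S = sE C.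
Proof.
move=> cC sSC clS /set0Pn[e eS]; apply/eqP; rewrite eqEsubset sSC.
apply/subsetP => f fC.
have eC := subsetP sSC _ eS.
have inV g : g \in sE C -> src g \in sV C.
  by move=> gC; rewrite -coherent_cycle_src ?imset_f.
have /connectP[p] := coherent_cycle_connect cC (inV e eC) (inV f fC).
have : src e \in src @: S by rewrite imset_f.
elim: p (src e) => [|w p IH] u /=.
  move=> /imsetP[g gS ->] _ fg.
  by rewrite (coherent_cycle_src_inj cC fC (subsetP sSC _ gS) fg).
move=> /imsetP[g gS ->] /andP[/exists_inP[h hC /andP[/eqP hs /eqP <-]] hp].
apply: IH => //; apply: (subsetP clS).
suff -> : h = g by rewrite imset_f.
by apply: (coherent_cycle_src_inj cC) => //; apply: (subsetP sSC).
Qed.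

(** A loop would be a closed singleton, hence by minimality all of [C], which has a second edge. *)
Lemma coherent_cycle_nonloop C e :
  is_coherent_cycle C -> e \in sE C -> ~~ is_loop e.
Proof.
move=> cC eC; apply/negP => /eqP le.
have [g gC] := coherent_cycle_neq e cC.
rewrite -(coherent_cycle_minimal cC (S := [set e])) ?sub1set // in gC.
- by rewrite (set1P gC) eqxx.
- by rewrite !imset_set1 le.
- by apply/set0Pn; exists e; rewrite set11.
Qed.

Lemma coherent_cycle_proper C S : is_coherent_cycle C ->
  S \proper sE C -> linear_forest S.
Proof.
move=> cC /properP[sSC [e eC eS]]; apply/linear_forestP; split.
- exact: sub_in2 (subsetP sSC) _ (coherent_cycle_src_inj cC).
- exact: sub_in2 (subsetP sSC) _ (coherent_cycle_tgt_inj cC).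
move=> S' sS clS'; apply/eqP/negP => /negP nz; case/negP: eS.
apply: (subsetP sS); rewrite (coherent_cycle_minimal cC _ clS' nz) //.
exact: subset_trans sSC.
Qed.

(** The successor map on [S] is injective because [tgt] is, so on the finite set [S] it is a
    permutation; any of its orbits is a cycle. *)
Lemma coherent_cycle_exists S :
    {in S, forall e, ~~ is_loop e} -> {in S &, injective src} ->
    {in S &, injective tgt} -> tgt @: S \subset src @: S -> S != set0 ->
  exists2 C, is_coherent_cycle C & sE C \subset S.
Proof.
move=> nl si ti clS /set0Pn[e0 e0S].
(* The default [e] is never reached on [S], since [S] is closed. *)
pose next e := odflt e [pick f in S | src f == tgt e].
have nextP e : e \in S -> next e \in S /\ src (next e) = tgt e.
  move=> eS; rewrite /next; case: pickP => [f /andP[fS /eqP ef]//|no].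
  have /imsetP[f fS ef] : tgt e \in src @: S by rewrite (subsetP clS) ?imset_f.
  by have := no f; rewrite fS ef eqxx.
have nS : {homo next : e / e \in S} by move=> e /nextP[].
have ni : {in S &, injective next}.
  move=> e f eS fS ef; apply: ti => //.
  by rewrite -(nextP e eS).2 -(nextP f fS).2 ef.
have cyc := cycle_orbit_in nS ni e0S.
set es := orbit next e0 in cyc.
have esS : {subset es <= S}.
  move=> f; rewrite -fconnect_orbit => /iter_findex <-.
  by elim: (findex _ _ _) => //= k; apply: nS.
have chn : cycle (@chain G) es.
  apply: (sub_in_cycle (P := mem S)) cyc; last by apply/allP.
  by move=> e f eS _ /= /eqP <-; rewrite /chain (nextP e eS).2.
have us : uniq (map src es).
  by rewrite map_inj_in_uniq ?orbit_uniq //; apply: sub_in2 esS _ si.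
have ts : map tgt es = rot 1 (map src es) by apply/eqP; rewrite -chain_cycleE.
(* An orbit of length one would be a loop. *)
have szes : 2 <= size es.
  have : e0 \in es by apply: in_orbit.
  move: esS chn; case: (es) => [|a [|b q]] //= aS; rewrite andbT => /eqP aa _.
  by have := nl a (aS a (mem_head _ _)); rewrite /is_loop aa eqxx.
have cl : [forall e in [set e in es],
    (src e \in [set u in map src es]) && (tgt e \in [set u in map src es])].
  apply/forall_inP => e; rewrite !inE => ees.
  by rewrite map_f // -(mem_rot 1) -ts map_f.
exists (Subgraph cl); last by apply/subsetP => e; rewrite inE => /esS.
by exists (map src es), es; split; rewrite ?size_map.
Qed.

(** With [coherent_cycle_component], reduces (MP2) to a local condition: every non-loop edge
    touching a coherent cycle belongs to it. *)
Lemma component_loopless_closed K e : is_component K (loopless G) ->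
  ~~ is_loop e -> (src e \in sV K) || (tgt e \in sV K) -> e \in sE K.
Proof.
move=> [v _ [-> ->]] nl; rewrite !inE nl.
have ad : adj (loopless G) (src e) (tgt e) by rewrite adj_edge // inE.
case/orP => vK; rewrite vK /=; last rewrite andbT.
  by rewrite (connect_trans vK) ?connect1.
by rewrite (connect_trans vK) ?connect1 // adj_sym.
Qed.

Lemma coherent_cycle_component C : is_coherent_cycle C ->
    (forall e, ~~ is_loop e -> (src e \in sV C) || (tgt e \in sV C) ->
      e \in sE C) ->
  is_component C (loopless G).
Proof.
move=> cC clC.
have endp e : e \in sE C -> (src e \in sV C) && (tgt e \in sV C).
  move=> eC; rewrite -{1}(coherent_cycle_src cC) -(coherent_cycle_tgt cC).
  by rewrite !imset_f.
have /coherent_cycle_chain[[|a es] [//= _ _ _ _ EC]] := cC.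
have aC : a \in sE C by rewrite EC !inE eqxx.
have /andP[vC _] := endp a aC.
exists (src a); first by rewrite inE.
split; last first.
  apply/setP => e; rewrite !inE; apply/idP/and3P => [eC|[nl es' _]].
    by have /andP[-> ->] := endp e eC; rewrite (coherent_cycle_nonloop cC).
  by rewrite clC ?es'.
apply/setP => w; rewrite inE; apply/idP/idP => [wC|vw].
  apply: connect_sub (coherent_cycle_connect cC vC wC) => s t.
  move=> /exists_inP[e eC /andP[/eqP <- /eqP <-]].
  by rewrite connect1 // adj_edge // inE (coherent_cycle_nonloop cC).
apply: connect_adj_closed vw vC => e; rewrite inE => nl ew.
exact/endp/clC.
Qed.

End CoherentCycles.

(** * Zigzags and the forbidden subgraphs *)

Definition zigzag (G : digraph) : Prop :=
  exists x y z : edge G,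
    [/\ [/\ ~~ is_loop x, ~~ is_loop y & ~~ is_loop z],
        x != y, y != z, tgt x = tgt y & src y = src z].

(** Reversal turns the zigzag [x, y, z] into [z, y, x], so the reversed forbidden digraphs contain
    zigzags as well. *)
Lemma zigzag_rev (G : digraph) : zigzag G -> zigzag (rev_digraph G).
Proof.
move=> [x [y [z [[nx ny nz] xy yz xyt yzs]]]]; exists z, y, x.
by split=> //; rewrite 1?eq_sym //; split; rewrite /is_loop eq_sym.
Qed.

Lemma zigzag_contains (G D : digraph) : contains G D -> zigzag D -> zigzag G.
Proof.
move=> [H [fV [fE [[iV iE] _ sE tE]]]].
move=> [x [y [z [[nx ny nz] xy yz xyt yzs]]]]; exists (fE x), (fE y), (fE z).
by split; rewrite ?inj_eq // ?tE ?sE ?xyt ?yzs //; split;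
  rewrite /is_loop sE tE inj_eq.
Qed.

(** An edge of [digraph_of_rel r] is determined by its endpoints, so any choice of edges of [G] over
    an injective vertex map is injective. *)
Lemma contains_of_rel (G : digraph) (V : finType) (r : rel V)
    (fV : V -> vertex G) :
    injective fV ->
    (forall u w, r u w -> exists2 e : edge G, src e = fV u & tgt e = fV w) ->
  contains G (digraph_of_rel r).
Proof.
move=> iV ex; pose D := digraph_of_rel r.
have /fin_all_exists[fE fEP] (d : edge D) :
    exists e : edge G, src e = fV (src d) /\ tgt e = fV (tgt d).
  by have [e] := ex _ _ (valP d); exists e.
have cl : [forall e in fE @: [set: edge D],
    (src e \in fV @: [set: vertex D]) && (tgt e \in fV @: [set: vertex D])].
  apply/forall_inP => _ /imsetP[d _ ->]; have [-> ->] := fEP d.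
  by rewrite !imset_f.
exists (Subgraph cl), fV, fE; split=> //; try by move=> d; have [] := fEP d.
split=> // d d' dd; have [s t] := fEP d; have [s' t'] := fEP d'.
rewrite dd in s t; apply: val_inj.
rewrite [val d]surjective_pairing [val d']surjective_pairing.
by congr (_, _); apply: iV; [rewrite -[LHS]s | rewrite -[LHS]t].
Qed.

Lemma zigzag_D_A : zigzag D_A.
Proof.
pose mk (u w : 'I_3) H : edge D_A :=
  exist (fun p : 'I_3 * 'I_3 => (nat_of_ord p.1, nat_of_ord p.2) \in
     [:: (1, 0); (0, 2); (1, 2)]) (u, w) H.
by exists (mk (@Ordinal 3 0 isT) (@Ordinal 3 2 isT) isT),
  (mk (@Ordinal 3 1 isT) (@Ordinal 3 2 isT) isT),
  (mk (@Ordinal 3 1 isT) (@Ordinal 3 0 isT) isT).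
Qed.

Lemma zigzag_D_B : zigzag D_B.
Proof.
pose mk (u w : 'I_4) H : edge D_B :=
  exist (fun p : 'I_4 * 'I_4 => (nat_of_ord p.1, nat_of_ord p.2) \in
     [:: (0, 1); (2, 1); (2, 3)]) (u, w) H.
by exists (mk (@Ordinal 4 0 isT) (@Ordinal 4 1 isT) isT),
  (mk (@Ordinal 4 2 isT) (@Ordinal 4 1 isT) isT),
  (mk (@Ordinal 4 2 isT) (@Ordinal 4 3 isT) isT).
Qed.

Lemma nth_ord_inj (T : eqType) (x0 : T) (n : nat) (s : seq T) :
  size s = n -> uniq s -> injective (fun i : 'I_n => nth x0 s i).
Proof.
move=> sz us i j /eqP; rewrite nth_uniq ?sz // => /eqP ij.
exact: val_inj.
Qed.

Lemma MP1_zigzag (G : digraph) : MP1 G <-> ~ zigzag G.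
Proof.
split=> [[nA nB _ _]|nz]; last first.
  split=> c; apply/nz/(zigzag_contains c); try apply: zigzag_rev;
    by [exact: zigzag_D_A | exact: zigzag_D_B].
move=> [x [y [z [[nx ny nz] xy yz xyt yzs]]]].
have xys : src x != src y.
  by apply: contraNneq xy => xys; apply/eqP/nonloop_edge_uniq.
have yzt : tgt y != tgt z.
  by apply: contraNneq yz => yzt; apply/eqP/nonloop_edge_uniq.
rewrite /is_loop xyt in nx; rewrite /is_loop -yzs in nz.
(* This is the only coincidence left open among the four endpoints: any other would give a loop or
   two parallel edges. Equality yields [D_A], inequality [D_B]. *)
have [xz|xz] := eqVneq (src x) (tgt z).
  apply: nA; pose s := [:: src x; src y; tgt y].
  apply: (contains_of_rel (fV := fun i : 'I_3 => nth (src x) s i)).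
    by apply: nth_ord_inj; rewrite //= !inE negb_or xys nx ny.
  move=> u w; rewrite !inE !xpair_eqE.
  case/or3P => /andP[/eqP-> /eqP->] /=.
  - by exists z.
  - by exists x.
  - by exists y.
apply: nB; pose s := [:: src x; tgt y; src y; tgt z].
apply: (contains_of_rel (fV := fun i : 'I_4 => nth (src x) s i)).
  apply: nth_ord_inj; rewrite //= !inE !negb_or nx xys xz yzt nz !andbT /=.
  by rewrite eq_sym.
move=> u w; rewrite !inE !xpair_eqE.
case/or3P => /andP[/eqP-> /eqP->] /=.
- by exists x.
- by exists y.
- by exists z.
Qed.

(** * The exchange property and conditions (MP1), (MP2) *)

Section Exchange.
Variable G : digraph.
Implicit Types (A B S : {set edge G}) (C : subgraph G) (e f g x y z : edge G).

Definition conflict e f := (src e == src f) || (tgt e == tgt f).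

Lemma conflict_sym : symmetric conflict.
Proof.
by move=> e f; rewrite /conflict eq_sym [tgt e == _]eq_sym.
Qed.

Lemma linear_forest_conflict A e f :
  linear_forest A -> e \in A -> f \in A -> conflict e f -> e = f.
Proof.
by move=> /linear_forestP[si ti _] eA fA /orP[]/eqP; [apply: si|apply: ti].
Qed.

Lemma linear_forest1 e : ~~ is_loop e -> linear_forest [set e].
Proof.
move=> ne; apply/linear_forestP; split; try by move=> a b /set1P-> /set1P->.
move=> S; rewrite subset1 => /orP[]/eqP->// /subsetP/(_ (tgt e)).
by rewrite !imset_set1 !inE eqxx eq_sym => /(_ isT) le; rewrite /is_loop le in ne.
Qed.

(** A closed set cannot contain [e], whose successor in it would be [e] or [f]; so it lies in
    [[set f]]. The case [tgt f = src e] is permitted, as it occurs for zigzags of shape [D_A]. *)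
Lemma linear_forest2 e f : ~~ is_loop e -> ~~ is_loop f -> ~~ conflict e f ->
  tgt e != src f -> linear_forest [set e; f].
Proof.
move=> ne nf /norP[/negPf nes /negPf net] ef.
apply/linear_forestP; split.
- by move=> a b /set2P[]-> /set2P[]-> // /eqP; rewrite ?nes // eq_sym nes.
- by move=> a b /set2P[]-> /set2P[]-> // /eqP; rewrite ?net // eq_sym net.
move=> S /subsetP sS clS.
have eS : e \notin S.
  apply/negP => eS; have := subsetP clS _ (imset_f tgt eS).
  move=> /imsetP[g /sS/set2P[]-> /eqP]; last by rewrite (negPf ef).
  by rewrite eq_sym; apply/negP.
have /linear_forestP[_ _ ac] := linear_forest1 nf.
apply: ac => //; apply/subsetP => g gS; rewrite inE.
by have /set2P[ge|->//] := sS g gS; rewrite -ge gS in eS.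
Qed.

Lemma matroid_linear_forest : matroid (@Mult G) <->
  forall A B, linear_forest A -> linear_forest B -> #|B| < #|A| ->
    exists2 x, x \in A :\: B & linear_forest (x |: B).
Proof.
split=> [[_ _ ex] A B /MultP lA /MultP lB BA|ex].
  by have [x xAB /MultP lx] := ex A B lA lB BA; exists x.
split.
- exact/MultP/linear_forest0.
- by move=> A B sAB /MultP lB; apply/MultP/(linear_forestS sAB).
- move=> A B /MultP lA /MultP lB BA.
  by have [x xAB /MultP lx] := ex A B lA lB BA; exists x.
Qed.

Lemma matroid_no_zigzag : matroid (@Mult G) -> ~ zigzag G.
Proof.
move=> /matroid_linear_forest ex [x [y [z [[nx ny nz] xy yz xyt yzs]]]].
have xys : src x != src z.
  by rewrite -yzs; apply: contraNneq xy => xys; apply/eqP/nonloop_edge_uniq.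
have yzt : tgt x != tgt z.
  by rewrite xyt; apply: contraNneq yz => yzt; apply/eqP/nonloop_edge_uniq.
have lxz : linear_forest [set x; z].
  apply: linear_forest2; rewrite // /conflict ?negb_or ?xys //.
  by rewrite xyt -yzs eq_sym.
have [|w] := ex _ _ lxz (linear_forest1 ny).
  have xz : x != z by apply: contraNneq xys => ->.
  by rewrite cards1 cards2 xz.
rewrite !inE => /andP[wy wxz] lw.
(* Whichever of [x] and [z] is added, it shares an endpoint with [y]. *)
suff cwy : conflict w y.
  by rewrite (linear_forest_conflict lw _ _ cwy) ?inE ?eqxx ?orbT in wy.
by case/orP: wxz => /eqP->; rewrite /conflict ?xyt ?yzs eqxx ?orbT.
Qed.

(** Here [x] leaves the cycle. In a closed set containing [x], the vertex [tgt x] would be a source,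
    but all sources lie on [C]; so closed sets avoid [x] and lie in a proper part of [C]. *)
Lemma linear_forest_swap_src C x e : is_coherent_cycle C ->
    e \in sE C -> src e = src x -> tgt x \notin sV C ->
  linear_forest (x |: sE C :\ e).
Proof.
move=> cC eC es xC.
have /linear_forestP[si ti ac] : linear_forest (sE C :\ e).
  by apply: (coherent_cycle_proper cC); rewrite properD1.
have inC f : f \in sE C :\ e -> f \in sE C by rewrite inE => /andP[].
have tC f : f \in sE C :\ e -> tgt f <> tgt x.
  by move=> /inC fC fx; rewrite -fx -(coherent_cycle_tgt cC) imset_f in xC.
have sC f : f \in sE C :\ e -> src f <> src x.
  move=> fC; rewrite -es => /(coherent_cycle_src_inj cC (inC _ fC) eC) fe.
  by rewrite fe !inE eqxx in fC.
apply/linear_forestP; split.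
- move=> f g /setU1P[->|fC] /setU1P[->|gC] //; last exact: si.
    by move/esym => /(sC _ gC).
  by move/(sC _ fC).
- move=> f g /setU1P[->|fC] /setU1P[->|gC] //; last exact: ti.
    by move/esym => /(tC _ gC).
  by move/(tC _ fC).
move=> S /subsetP sS clS; apply: ac => //; apply/subsetP => f fS.
have /setU1P[fx|//] := sS f fS; case/negP: xC.
have /imsetP[g gS ->] : tgt x \in src @: S.
  by rewrite (subsetP clS) // -fx imset_f.
rewrite -(coherent_cycle_src cC).
by have /setU1P[->|/inC gC] := sS g gS; rewrite -?es imset_f.
Qed.

(** Here [x] enters the cycle from outside. *)
Lemma linear_forest_swap_tgt C x e : is_coherent_cycle C -> ~~ is_loop x ->
    e \in sE C -> tgt e = tgt x -> src x \notin sV C ->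
  linear_forest (x |: sE C :\ e).
Proof.
move=> cC nx eC es xC.
have /linear_forestP[si ti ac] : linear_forest (sE C :\ e).
  by apply: (coherent_cycle_proper cC); rewrite properD1.
have inC f : f \in sE C :\ e -> f \in sE C by rewrite inE => /andP[].
have sC f : f \in sE C :\ e -> src f <> src x.
  by move=> /inC fC fx; rewrite -fx -(coherent_cycle_src cC) imset_f in xC.
have tC f : f \in sE C :\ e -> tgt f <> tgt x.
  move=> fC; rewrite -es => /(coherent_cycle_tgt_inj cC (inC _ fC) eC) fe.
  by rewrite fe !inE eqxx in fC.
apply/linear_forestP; split.
- move=> f g /setU1P[->|fC] /setU1P[->|gC] //; last exact: si.
    by move/esym => /(sC _ gC).
  by move/(sC _ fC).
- move=> f g /setU1P[->|fC] /setU1P[->|gC] //; last exact: ti.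
    by move/esym => /(tC _ gC).
  by move/(tC _ fC).
move=> S /subsetP sS clS.
have S'0 : S :\ x = set0.
  apply: ac.
    by apply/subsetP => f /setD1P[fx /sS/setU1P[/eqP|//]]; rewrite (negPf fx).
  apply/subsetP => _ /imsetP[f /setD1P[fx fS] ->].
  have /imsetP[g gS fg] : tgt f \in src @: S by rewrite (subsetP clS) ?imset_f.
  rewrite fg imset_f // !inE gS andbT; apply/eqP => gx; case/negP: xC.
  rewrite -gx -fg -(coherent_cycle_tgt cC) imset_f //.
  by have /setU1P[/eqP|/inC//] := sS f fS; rewrite (negPf fx).
apply/eqP/set0Pn => -[f fS].
have eqx g : g \in S -> g = x.
  by move=> gS; apply/eqP; have /setP/(_ g) := S'0; rewrite !inE gS andbT => /negPn.
have /imsetP[g gS fg] : tgt f \in src @: S by rewrite (subsetP clS) ?imset_f.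
by case/negP: nx; rewrite /is_loop -{1}(eqx g gS) -fg (eqx f fS).
Qed.

Lemma matroid_MP2 : matroid (@Mult G) -> MP2 G.
Proof.
move=> mG C cC; have nzz := matroid_no_zigzag mG.
move/matroid_linear_forest in mG.
apply: (coherent_cycle_component cC) => x nx xC; apply/negPn/negP => xnC.
(* Exchange into [sE C :\ g] with [g != e] can only add [x], which conflicts with the remaining [e],
   or [g], which completes the cycle. *)
have no_swap e : e \in sE C -> conflict x e -> ~~ linear_forest (x |: sE C :\ e).
  move=> eC xe; apply/negP => lA.
  have [g gC ge] := coherent_cycle_neq e cC.
  have lB : linear_forest (sE C :\ g).
    by apply: (coherent_cycle_proper cC); rewrite properD1.
  have [|w] := mG _ _ lA lB.
    have := cardsD1 e (sE C); have := cardsD1 g (sE C).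
    rewrite eC gC cardsU1 !inE negb_and xnC orbT !add1n => -> [->].
    exact: ltnSn.
  rewrite !inE => /andP[wB /predU1P[->|/andP[we wC]]] lw.
    have := linear_forest_conflict lw _ _ xe.
    rewrite !inE eqxx eC andbT [e == g]eq_sym ge orbT.
    by move=> /(_ isT isT) xe'; rewrite xe' eC in xnC.
  move: wB; rewrite wC andbT => /negPn/eqP wg.
  have /linear_forestP[_ _ /(_ (sE C))] := lw.
  rewrite wg setD1K // => /(_ (subxx _)).
  rewrite (coherent_cycle_tgt cC) (coherent_cycle_src cC) => /(_ (subxx _)).
  by move=> C0; rewrite C0 inE in gC.
have [sxC|sxC] := boolP (src x \in sV C); last first.
  move: xC; rewrite (negPf sxC) /= -(coherent_cycle_tgt cC) => /imsetP[e eC xe].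
  have cxe : conflict x e by rewrite /conflict xe eqxx orbT.
  by case/negP: (no_swap e eC cxe); apply: linear_forest_swap_tgt.
have := sxC; rewrite -(coherent_cycle_src cC) => /imsetP[e eC xe].
have [txC|txC] := boolP (tgt x \in sV C); last first.
  have cxe : conflict x e by rewrite /conflict xe eqxx.
  by case/negP: (no_swap e eC cxe); apply: linear_forest_swap_src.
(* Now [x] is a chord: the cycle edge [f] into its target and the cycle edge [e] out of its source
   form a zigzag with [x] in the middle. *)
move: txC; rewrite -(coherent_cycle_tgt cC) => /imsetP[f fC xf].
apply: nzz; exists f, x, e; split=> //.
- by split; rewrite // (coherent_cycle_nonloop cC).
- by apply: contraNneq xnC => <-.
- by apply: contraNneq xnC => ->.
Qed.

(** Two conflicts of the same kind compose by equality; two of different kinds at [y] make a zigzag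
    with middle edge [y]. *)
Lemma conflict_trans : ~ zigzag G -> forall x y z,
  ~~ is_loop x -> ~~ is_loop y -> ~~ is_loop z ->
  conflict x y -> conflict y z -> conflict x z.
Proof.
move=> nzz x y z nx ny nz.
have [->//|xy] := eqVneq x y; have [->//|yz] := eqVneq y z.
move=> /orP[]/eqP xye /orP[]/eqP yze.
- by rewrite /conflict xye yze eqxx.
- by case: nzz; exists z, y, x; split=> //; rewrite eq_sym.
- by case: nzz; exists x, y, z.
- by rewrite /conflict xye yze eqxx orbT.
Qed.

(** Retains what the counting argument uses of the edge set of a coherent cycle under (MP2). *)
Definition isolated_closed S :=
  tgt @: S \subset src @: S /\
  forall f g, f \in S -> ~~ is_loop g -> conflict f g -> f = g.

(** The successors of an edge in [S] and in [S'] share their source, so isolation of [S'] identifies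
    them. *)
Lemma isolated_closedI S S' :
  {in S, forall e, ~~ is_loop e} ->
  isolated_closed S -> isolated_closed S' ->
  tgt @: (S :&: S') \subset src @: (S :&: S').
Proof.
move=> nl [clS _] [clS' isS'].
apply/subsetP => _ /imsetP[f /setIP[fS fS'] ->].
have /imsetP[g gS fg] : tgt f \in src @: S by rewrite (subsetP clS) ?imset_f.
have /imsetP[h hS' fh] : tgt f \in src @: S' by rewrite (subsetP clS') ?imset_f.
rewrite fg imset_f // inE gS -(isS' h g) ?nl //.
by rewrite /conflict -fg fh eqxx.
Qed.

(** Without a conflict, [src] and [tgt] stay injective on [x |: A], so the failure is a coherent
    cycle. It passes through [x] because [A] is acyclic, and (MP2) isolates it. *)
Lemma dependent_conflict_or_cycle A x : MP2 G -> linear_forest A ->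
    ~~ is_loop x -> ~~ linear_forest (x |: A) ->
  (exists2 y, y \in A & conflict x y) \/
  exists S, [/\ S \subset x |: A, x \in S & isolated_closed S].
Proof.
move=> mp2 lA nx; have /linear_forestP[si ti ac] := lA.
have [/exists_inP[y yA xy]|nc] := boolP [exists y in A, conflict x y].
  by left; exists y.
move=> dep; right.
have {}nc y : y \in A ->
    (src x == src y = false) * (tgt x == tgt y = false).
  move=> yA; suff /norP[/negPf-> /negPf->] : ~~ conflict x y by [].
  by apply: contraNN nc => xy; apply/exists_inP; exists y.
have si' : {in x |: A &, injective src}.
  move=> f g /setU1P[->|fA] /setU1P[->|gA] //; last exact: si.
    by move/eqP; rewrite nc.
  by move/esym/eqP; rewrite nc.
have ti' : {in x |: A &, injective tgt}.
  move=> f g /setU1P[->|fA] /setU1P[->|gA] //; last exact: ti.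
    by move/eqP; rewrite nc.
  by move/esym/eqP; rewrite nc.
have nl' : {in x |: A, forall e, ~~ is_loop e}.
  by move=> e /setU1P[->//|]; apply: linear_forest_nonloop.
move: dep; rewrite /linear_forest => /nandP[/dinjectiveP//|/nandP[/dinjectiveP//|]].
rewrite negb_forall => /existsP[S]; rewrite negb_imply => /andP[/andP[sS clS] S0].
have sub := subsetP sS.
have [C cC CS] : exists2 C, is_coherent_cycle C & sE C \subset S.
  apply: coherent_cycle_exists => //.
  - by move=> e /sub; apply: nl'.
  - exact: sub_in2 sub _ si'.
  - exact: sub_in2 sub _ ti'.
have clC : tgt @: sE C \subset src @: sE C.
  by rewrite (coherent_cycle_tgt cC) (coherent_cycle_src cC).
have CxA : sE C \subset x |: A by apply: subset_trans sS.
exists (sE C); split=> //.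
  apply/negPn/negP => xC; have [g gC _] := coherent_cycle_neq x cC.
  suff C0 : sE C = set0 by rewrite C0 inE in gC.
  apply: ac => //; apply/subsetP => f fC.
  by have /setU1P[fx|//] := subsetP CxA f fC; rewrite -fx fC in xC.
split=> // f g fC ng fg.
have gC : g \in sE C.
  apply: (component_loopless_closed (mp2 C cC)) => //.
  rewrite -{1}(coherent_cycle_src cC) -(coherent_cycle_tgt cC).
  by case/orP: fg => /eqP <-; apply/orP; [left|right]; apply: imset_f.
case/orP: fg => /eqP; first exact: (coherent_cycle_src_inj cC).
exact: (coherent_cycle_tgt_inj cC).
Qed.

Lemma matroid_of_MP : ~ zigzag G -> MP2 G -> matroid (@Mult G).
Proof.
move=> nzz mp2; apply/matroid_linear_forest => A B lA lB ltBA.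
have [/exists_inP[x]|no] := boolP [exists x in A :\: B, linear_forest (x |: B)].
  by exists x.
have /linear_forestP[_ _ acA] := lA; have /linear_forestP[_ _ acB] := lB.
have nlA x : x \in A -> ~~ is_loop x by apply: linear_forest_nonloop.
have nlB x : x \in B -> ~~ is_loop x by apply: linear_forest_nonloop.
pose blocks x y := conflict x y \/
  exists S, [/\ S \subset x |: B, x \in S, isolated_closed S & y \in S].
(* The implication sits under the existential so that [phi] is a total function; outside [A :\: B]
   its value is a dummy. *)
have ex x : exists y, x \in A :\: B -> y \in B :\: A /\ blocks x y.
  have [xAB|] := boolP (x \in A :\: B); last by exists x.
  have /setDP[xA xB] := xAB.
  have dep : ~~ linear_forest (x |: B).
    by apply: contraNN no => lx; apply/exists_inP; exists x.
  case: (dependent_conflict_or_cycle mp2 lB (nlA x xA) dep).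
    move=> [y yB xy]; exists y => _; split; last by left.
    rewrite inE yB andbT; apply/negP => yA.
    by rewrite (linear_forest_conflict lA xA yA xy) yB in xB.
  move=> [S [sS xS icS]].
  (* Since [A] is acyclic, the closed set [S] has an edge outside [A]; that edge is not [x], so it
     lies in [B]. *)
  have /subsetPn[y yS yA] : ~~ (S \subset A).
    apply/negP => SA; have S0 := acA S SA icS.1.
    by rewrite S0 inE in xS.
  exists y => _; split; last by right; exists S.
  rewrite inE yA; have /setU1P[yx|//] := subsetP sS y yS.
  by rewrite yx xA in yA.
have [phi phiP] := fin_all_exists ex.
have phi_inj : {in A :\: B &, injective phi}.
  (* The two kinds of blocking cannot meet at one [y]: isolation of [S] would give [y = x'],
     although [y] is not in [A]. *)
  have mixed x x' y : x' \in A -> y \notin A -> y \in B -> conflict x' y ->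
      ~ exists S, [/\ S \subset x |: B, x \in S, isolated_closed S & y \in S].
    move=> x'A yA yB x'y [S [_ _ [_ isS] yS]].
    rewrite conflict_sym in x'y.
    by rewrite (isS _ _ yS (nlA _ x'A) x'y) x'A in yA.
  move=> x x' xAB x'AB eq_phi.
  have [/setDP[yB yA] bx] := phiP x xAB; have [_] := phiP x' x'AB.
  rewrite -eq_phi; move: (phi x) yB yA bx => y yB yA bx bx'.
  have /setDP[xA xB] := xAB; have /setDP[x'A x'B] := x'AB.
  case: bx bx' => [xy|bx] [x'y|bx'].
  (* Transitivity through [y] makes [x] and [x'] conflict inside the linear forest [A]. *)
  - apply: (linear_forest_conflict lA xA x'A).
    apply: (conflict_trans nzz (nlA x xA) (nlB y yB)) => //; first exact: nlA.
    by rewrite conflict_sym.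
  - by case: (mixed _ _ _ xA yA yB xy bx').
  - by case: (mixed _ _ _ x'A yA yB x'y bx).
  case: bx bx' => [S [sS xS icS yS]] [S' [sS' x'S' icS' yS']].
  have nlS : {in S, forall e, ~~ is_loop e}.
    by move=> e /(subsetP sS)/setU1P[->|/nlB//]; apply: nlA.
  have clI := isolated_closedI nlS icS icS'.
  (* The intersection is nonempty and closed, so it cannot lie inside [B]. *)
  have xS' : x \in S'.
    apply/negPn/negP => xS'; suff /setP/(_ y) : S :&: S' = set0.
      by rewrite !inE yS yS'.
    apply: acB => //; apply/subsetP => f /setIP[fS fS'].
    by have /setU1P[fx|//] := subsetP sS f fS; rewrite -fx fS' in xS'.
  by have /setU1P[//|xB'] := subsetP sS' x xS'; rewrite xB' in xB.
(* Adding [#|A :&: B|] to both sides contradicts [#|B| < #|A|]. *)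
have : #|A :\: B| <= #|B :\: A|.
  rewrite -(card_in_imset phi_inj); apply/subset_leq_card/subsetP.
  by move=> _ /imsetP[x xAB ->]; have [] := phiP x xAB.
by rewrite leqNgt -(ltn_add2l #|A :&: B|) {1}setIC !cardsID ltBA.
Qed.

End Exchange.

Theorem theorem4p12 (G : digraph) :
  matroid (@Mult G) <-> MP1 G /\ MP2 G.
Proof.
split=> [mG|[/MP1_zigzag nz mp2]]; last exact: matroid_of_MP.
by split; [apply/MP1_zigzag/matroid_no_zigzag|apply: matroid_MP2].
Qed.
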